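(* Let $\mathcal S=\{G\in\operatorname{Sym}_2^+(\mathbb R):\det G=1\}$ and $\Theta:\mathcal S\to\mathbb R^3$, $\Theta(G)=\bigl(E_{(1,0)}(G),E_{(0,1)}(G),E_{(1,1)}(G)\bigr)$, be as in the context. The map $\Theta$ is injective, and its differential $D\Theta_G$ is injective for every $G\in\mathcal S$. In particular, $g_R=\Theta^*g_{\mathbb R^3}$ is a Riemannian metric on all of $\mathcal S$.
   Context: $\operatorname{Sym}_2^+(\mathbb R)$ is the set of real symmetric positive-definite $2\times2$ matrices. Let $T^2=\mathbb R^2/\mathbb Z^2$, and for $G\in\operatorname{Sym}_2^+(\mathbb R)$ let $g_G$ be the constant (flat) Riemannian metric on $T^2$ with matrix $G$; its volume is $\sqrt{\det G}$. $\mathcal S$, the space of marked unit-volume flat metrics, is a smooth two-dimensional manifold with $T_G\mathcal S=\{H\in\operatorname{Sym}_2(\mathbb R):\operatorname{tr}(G^{-1}H)=0\}$. For $m=(m_1,m_2)\in\mathbb Z^2$ let $u_m:T^2\to S^1=\mathbb R/\mathbb Z$, $u_m(x)=m_1x^1+m_2x^2 \pmod{\mathbb Z}$, where $S^1$ carries its flat metric, and let $E_m(G)=\frac12\int_{T^2}|du_m|^2_{g_G}\,dV_{g_G}=\frac12 m^TG^{-1}m$ be its energy. $g_{\mathbb R^3}$ is the Euclidean metric on $\mathbb R^3$. *)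

(* Defs.v *)
From HB Require Import structures.
From mathcomp Require Import all_boot all_order all_algebra.
From mathcomp Require Import all_classical all_reals all_analysis.

Set Implicit Arguments.
Unset Strict Implicit.
Unset Printing Implicit Defensive.

Import Order.TTheory GRing.Theory Num.Theory.
Import numFieldNormedType.Exports.

Local Open Scope classical_set_scope.
Local Open Scope ring_scope.

Section Smoothness.
Context {R : realType}.

(* [Ck k U f] : [f] is of class C^k on the open set [U].  It is only meant for
   open [U] and finite-dimensional [V], where continuity of all directional
   derivatives is the same as continuity of the differential. *)
Fixpoint Ck {V W : normedModType R} (k : nat) (U : set V) (f : V -> W) : Prop :=
  match k with
  | 0 => forall x, U x -> {for x, continuous f}
  | k'.+1 => (forall x, U x -> differentiable f x) /\
             (forall v : V, Ck k' U (fun x => 'D_v f x))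
  end.

Definition smooth {V W : normedModType R} (U : set V) (f : V -> W) : Prop :=
  forall k, Ck k U f.

(* A map defined on a subset [M] of a vector space (only the values of [f] on
   [M] matter) is smooth when it extends, locally around each point of [M], to
   a smooth map on an open set of the ambient space. *)
Definition smooth_on {V W : normedModType R} (M : set V) (f : V -> W) : Prop :=
  forall p, M p -> exists U : set V, exists F : V -> W,
    [/\ open U, U p, smooth U F & forall q, U q -> M q -> F q = f q].

(* [c] is a curve in [M] with [c(0) = p] and [c'(0) = v].  Differentiability
   of [c] at 0 suffices for [mdiff] below, which is used for maps that are
   smooth on [M]. *)
Definition curve_at {V : normedModType R} (M : set V) (p v : V) (c : R -> V)
    : Prop :=
  [/\ c 0 = p, \forall t \near (0 : R), M (c t) & is_derive (0 : R) 1 c v].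

(* The differential at [p] of a map [f] on the submanifold [M], applied to the
   tangent vector [v]: the derivative at 0 of [f \o c] for some curve [c] in
   [M] through [p] with velocity [v].  When [f] is smooth on [M] and [v] is
   tangent to [M] at [p], it does not depend on the chosen [c]; the default
   value [cst p] is used only when there is no such curve. *)
Definition mdiff {V W : normedModType R} (M : set V) (f : V -> W) (p v : V)
    : W :=
  derive1 (f \o xget (cst p) [set c | curve_at M p v c]) 0.

(* A Riemannian metric on the submanifold [M] of [V] with tangent spaces [T p]
   is a function [g p v w] of a point and two vectors, whose values matter only
   for [p] in [M] and [v], [w] in [T p].  The last clause is smoothness of the
   tensor field, tested on smooth tangent vector fields. *)
Definition riemannian_metric {V : normedModType R} (M : set V)
    (T : V -> set V) (g : V -> V -> V -> R) : Prop :=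
  [/\ forall p, M p -> forall (a : R) (u v w : V), T p u -> T p v -> T p w ->
        g p (a *: u + v) w = a * g p u w + g p v w,
      forall p, M p -> forall v w : V, T p v -> T p w -> g p v w = g p w v,
      forall p, M p -> forall v : V, T p v -> v != 0 -> 0 < g p v v
    & forall X Y : V -> V,
        smooth_on M X -> (forall p, M p -> T p (X p)) ->
        smooth_on M Y -> (forall p, M p -> T p (Y p)) ->
        smooth_on M (fun p => g p (X p) (Y p))].

Definition pullback {V W : normedModType R} (M : set V) (f : V -> W)
    (h : W -> W -> W -> R) : V -> V -> V -> R :=
  fun p v w => h (f p) (mdiff M f p v) (mdiff M f p w).

Definition euclidean_metric (x v w : 'rV[R]_3) : R :=
  \sum_(i < 3) v 0 i * w 0 i.

End Smoothness.

Section FlatTori.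
Context {R : realType}.

Definition sym_posdef : set 'M[R]_2 :=
  [set G | G^T = G /\
           forall v : 'cV[R]_2, v != 0 -> 0 < (v^T *m G *m v) 0 0].

Definition unit_flat : set 'M[R]_2 := [set G | sym_posdef G /\ \det G = 1].

Definition tangent_unit_flat (G : 'M[R]_2) : set 'M[R]_2 :=
  [set H | H^T = H /\ \tr (invmx G *m H) = 0].

(* Maps from R^2/Z^2 to R/Z are given by a lift [u : R * R -> R], whose
   differential is the differential of the map. *)
Definition dlift (u : R * R -> R) (x : R * R) : 'rV[R]_2 :=
  \row_(i < 2) (if i == 0 then 'D_(1, 0) u x else 'D_(0, 1) u x).

(* The squared norm of the covector [du] for [g_G] uses the inverse matrix. *)
Definition sqnorm_d (G : 'M[R]_2) (u : R * R -> R) (x : R * R) : R :=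
  (dlift u x *m invmx G *m (dlift u x)^T) 0 0.

(* The torus is integrated over the fundamental domain [0, 1]^2, with the
   volume form dV = sqrt(det G) dx^1 dx^2 of [g_G]. *)
Definition dirichlet_energy (G : 'M[R]_2) (u : R * R -> R) : R :=
  2^-1 * \int[(lebesgue_measure \x lebesgue_measure)%E]_(x in
            (`[0, 1]%classic : set R) `*` (`[0, 1]%classic : set R))
            (sqnorm_d G u x * Num.sqrt (\det G)).

Definition torus_map (m : int * int) (x : R * R) : R :=
  m.1%:~R * x.1 + m.2%:~R * x.2.

(* [torus_map m] descends to a map R^2/Z^2 -> R/Z. *)
Lemma torus_map_translate (m k : int * int) (x : R * R) :
  torus_map m (x.1 + k.1%:~R, x.2 + k.2%:~R) =
  torus_map m x + (m.1 * k.1 + m.2 * k.2)%:~R.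
Proof. by rewrite /torus_map /= !mulrDr intrD !intrM addrACA. Qed.

Definition energy (m : int * int) (G : 'M[R]_2) : R :=
  dirichlet_energy G (torus_map m).

Definition Theta (G : 'M[R]_2) : 'rV[R]_3 :=
  \row_(i < 3) energy (tnth [tuple (1, 0); (0, 1); (1, 1)] i) G.

End FlatTori.

(* Main.v *)
(* For det G = 1 the inverse of G is its adjugate, so on unit_flat the map Theta
   is the restriction of the linear map (entries numbered from 0)
     energy_form G = (G11, G00, G00 + G11 - 2 G01) / 2,
   which is injective on symmetric matrices.  This gives injectivity and
   smoothness of Theta; and since every tangent vector is the velocity of an
   explicit curve, the differential of Theta at any G is energy_form itself,
   hence injective, and the pulled back Euclidean metric is positive definite. *)
Require Import Defs.
From HB Require Import structures.
From mathcomp Require Import all_boot all_order all_algebra.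
From mathcomp Require Import all_classical all_reals all_analysis.
From mathcomp Require Import ring lra.

Set Implicit Arguments.
Unset Strict Implicit.
Unset Printing Implicit Defensive.

Import Order.TTheory GRing.Theory Num.Theory.
Import numFieldNormedType.Exports.

Local Open Scope classical_set_scope.
Local Open Scope ring_scope.

(** * Calculus of C^k maps on open sets *)

(** Both maps have the same first-order expansion at [x], so uniqueness of the differential makes
    ['d f x] the differential of [g]. *)
Lemma near_eq_differentiable (R : realType) (V W : normedModType R)
    (f g : V -> W) (x : V) :
  (\forall y \near x, f y = g y) -> differentiable f x -> differentiable g x.
Proof.
move=> fg df.
have dgE : g \o shift x = cst (g x) + 'd f x +o_ 0 id.
  apply/eqaddoP => e e0.
  have /eqaddoP/(_ e e0) := diff_locally df.
  have : \forall h \near (0 : V), f (h + x) = g (h + x).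
    by have := fg; rewrite (near_shift 0 x); apply: filterS => h /=; rewrite subr0.
  apply: filterS2 => h /= fgh.
  by rewrite !fctE /= fgh (nbhs_singleton fg).
have := diff_unique (diff_continuous df) dgE => dgf.
by apply/diff_locallyP; rewrite dgf; split => //; exact: diff_continuous.
Qed.

Section Ck_theory.
Context {R : realType} {V : normedModType R}.
Implicit Types (U : set V).

Lemma Ck_subset (W : normedModType R) k U U' (f : V -> W) :
  U' `<=` U -> Ck k U f -> Ck k U' f.
Proof.
move=> U'U; elim: k f => [|k IHk] f /=; first by move=> fc x /U'U; exact: fc.
by move=> [df Df]; split=> [x /U'U /df//|v]; exact: IHk (Df v).
Qed.

(** Openness turns equality on [U] into equality near each of its points, so the directional
    derivatives agree on [U] too and the induction goes through. *)
Lemma Ck_ext (W : normedModType R) k U (f g : V -> W) :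
  open U -> (forall x, U x -> f x = g x) -> Ck k U f -> Ck k U g.
Proof.
move=> oU; elim: k f g => [|k IHk] f g fg /=.
  move=> fc x Ux; rewrite /prop_for /continuous_at -(fg x)//.
  apply: cvg_trans (fc x Ux); apply: near_eq_cvg.
  by near=> y; rewrite fg//; near: y; exact: open_nbhs_nbhs.
have nfg x : U x -> \forall y \near x, f y = g y.
  by move=> Ux; near=> y; apply: fg; near: y; exact: open_nbhs_nbhs.
move=> [df Df]; split=> [x Ux|v].
  exact: near_eq_differentiable (nfg x Ux) (df x Ux).
by apply: IHk (Df v) => x Ux; exact/near_eq_derive/nfg.
Unshelve. all: by end_near.
Qed.

Lemma Ck_pred (W : normedModType R) k U (f : V -> W) : Ck k.+1 U f -> Ck k U f.
Proof.
elim: k f => [|k IHk] f [df Df].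
  by move=> x Ux; exact/differentiable_continuous/df.
by split=> // v; exact/IHk/Df.
Qed.

Lemma Ck_cst (W : normedModType R) k U (a : W) : Ck k U (cst a).
Proof.
elim: k a => [|k IHk] a /=; first by move=> x _; exact: cst_continuous.
split=> [x _//|v].
by rewrite (_ : (fun x => _) = cst 0)//; apply/funext => x; rewrite derive_cst.
Qed.

Lemma Ck_linear (W : normedModType R) k U (f : {linear V -> W}) :
  continuous f -> Ck k U f.
Proof.
move=> fc; case: k => [|k] /=; first by move=> x _; exact: fc.
split=> [x _|v]; first exact: linear_differentiable.
rewrite (_ : (fun x => _) = cst (f v)); first exact: Ck_cst.
apply/funext => x; rewrite deriveE; last exact: linear_differentiable.
by rewrite diff_lin.
Qed.

(** Directional derivatives commute with [l], so each derivative of [l \o f] is [l] composed with a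
    derivative of [f]. *)
Lemma Ck_linear_comp (W W' : normedModType R) k U (f : V -> W)
    (l : {linear W -> W'}) :
  open U -> continuous l -> Ck k U f -> Ck k U (l \o f).
Proof.
move=> oU lc; elim: k f => [|k IHk] f /=.
  by move=> fc x Ux; apply: continuous_comp; [exact: fc|exact: lc].
move=> [df Df]; split=> [x Ux|v].
  by apply: differentiable_comp; [exact: df|exact: linear_differentiable].
apply: Ck_ext (IHk _ (Df v)) => // x Ux /=.
have dl y : differentiable l y by exact: linear_differentiable.
rewrite !deriveE; [|by apply: differentiable_comp; [exact: df|]|exact: df].
by rewrite (diff_comp (df x Ux))//= diff_lin.
Qed.

Lemma CkD (W : normedModType R) k U (f g : V -> W) :
  open U -> Ck k U f -> Ck k U g -> Ck k U (f + g).
Proof.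
move=> oU; elim: k f g => [|k IHk] f g /=.
  by move=> fc gc x Ux; apply: continuousD; [exact: fc|exact: gc].
move=> [df Df] [dg Dg]; split=> [x Ux|v].
  by apply: differentiableD; [exact: df|exact: dg].
apply: Ck_ext (IHk _ _ (Df v) (Dg v)) => // x Ux /=.
by rewrite deriveD//; apply: diff_derivable; [exact: df|exact: dg].
Qed.

Lemma CkM k U (f g : V -> R) :
  open U -> Ck k U f -> Ck k U g -> Ck k U (f * g).
Proof.
move=> oU; elim: k f g => [|k IHk] f g.
  by move=> fc gc x Ux; apply: continuousM; [exact: fc|exact: gc].
move=> Cf Cg; have [df Df] := Cf; have [dg Dg] := Cg; split=> [x Ux|v].
  by apply: differentiableM; [exact: df|exact: dg].
(* In the Leibniz rule each term pairs a derivative, of class C^k, with an undifferentiated factor,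
   which [Ck_pred] lowers to the same class. *)
have CD := CkD oU (IHk _ _ (Ck_pred Cf) (Dg v)) (IHk _ _ (Ck_pred Cg) (Df v)).
apply: Ck_ext CD => // x Ux /=.
by rewrite deriveM//; apply: diff_derivable; [exact: df|exact: dg].
Qed.

Lemma Ck_sum (W : normedModType R) n k U (f : 'I_n -> V -> W) :
  open U -> (forall i, Ck k U (f i)) -> Ck k U (fun x => \sum_i f i x).
Proof.
move=> oU; elim: n f => [|n IHn] f Cf.
  rewrite (_ : (fun x => _) = cst 0); first exact: Ck_cst.
  by apply/funext => x; rewrite big_ord0.
apply: Ck_ext (CkD oU (Cf ord0) (IHn _ (fun i => Cf (lift ord0 i)))) => // x _.
by rewrite big_ord_recl.
Qed.

End Ck_theory.

(** * Two-by-two matrices in coordinates *)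

Lemma ord2P (P : 'I_2 -> Prop) : P 0 -> P 1 -> forall i, P i.
Proof.
move=> P0 P1 [[|[|//]] li].
- by rewrite (_ : Ordinal li = 0)//; apply: val_inj.
- by rewrite (_ : Ordinal li = 1)//; apply: val_inj.
Qed.

Lemma mx2P (R : Type) (A B : 'M[R]_2) :
  [/\ A 0 0 = B 0 0, A 0 1 = B 0 1, A 1 0 = B 1 0 & A 1 1 = B 1 1] -> A = B.
Proof.
by case=> A00 A01 A10 A11; apply/matrixP; apply: ord2P; apply: ord2P.
Qed.

Lemma det2E (R : comNzRingType) (A : 'M[R]_2) :
  \det A = A 0 0 * A 1 1 - A 0 1 * A 1 0.
Proof.
rewrite (expand_det_row _ 0) !big_ord_recl big_ord0 /cofactor.
rewrite !(@det_mx11 R) !mxE /= addr0 expr0 expr1 mul1r mulN1r mulrN.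
by congr (A _ _ * A _ _ - A _ _ * A _ _); apply: val_inj.
Qed.

Lemma invmx2E (R : comUnitRingType) (A : 'M[R]_2) : \det A = 1 ->
  [/\ invmx A 0 0 = A 1 1, invmx A 0 1 = - A 0 1,
      invmx A 1 0 = - A 1 0 & invmx A 1 1 = A 0 0].
Proof.
move=> dA; rewrite /invmx unitmxE dA unitr1 invr1 scale1r.
split; rewrite !mxE /cofactor !(@det_mx11 R) !mxE ?mulN1r ?mul1r /=
  ?addn0 ?expr0 ?expr1 ?sqrrN ?expr1n ?mul1r ?mulN1r ?mulrNN//=.
- by congr (A _ _); apply: val_inj.
- by congr (- A _ _); apply: val_inj.
- by congr (- A _ _); apply: val_inj.
- by congr (A _ _); apply: val_inj.
Qed.

Lemma qform2E (R : comNzRingType) (A : 'M[R]_2) (v : 'cV[R]_2) :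
  (v^T *m A *m v) 0 0 = A 0 0 * v 0 0 ^+ 2 + (A 0 1 + A 1 0) * (v 0 0 * v 1 0)
                        + A 1 1 * v 1 0 ^+ 2.
Proof.
rewrite !mxE !big_ord_recl !big_ord0 !mxE !big_ord_recl !big_ord0 !mxE.
have -> : lift ord0 ord0 = 1 :> 'I_2 by apply: val_inj.
have -> : ord0 = 0 :> 'I_2 by [].
ring.
Qed.

(** This is Sylvester's criterion: the leading minors are [G 0 0] and the determinant, here 1. *)
Lemma unit_flatP (R : realType) (G : 'M[R]_2) :
  unit_flat G <-> [/\ G 1 0 = G 0 1, 0 < G 0 0 & G 0 0 * G 1 1 - G 0 1 ^+ 2 = 1].
Proof.
split=> [[[symG posG]]|[G10 G00 dG]]; rewrite ?det2E.
  have G10 : G 1 0 = G 0 1 by rewrite -[in LHS]symG mxE.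
  rewrite G10 -expr2 => dG; split=> //.
  have := posG (delta_mx 0 0); rewrite qform2E !mxE/= expr0n/= expr1n mulr1.
  rewrite !mulr0 !addr0; apply.
  by apply/eqP => /matrixP/(_ 0 0); rewrite !mxE/= => /eqP; rewrite oner_eq0.
split; last by rewrite det2E G10 -expr2.
split; first by apply: mx2P; rewrite !mxE.
(* Multiplying the form by [G 0 0 > 0] completes the square, leaving the determinant as the
   coefficient of [v 1 0 ^+ 2]. *)
move=> v v0; rewrite qform2E G10 -(pmulr_rgt0 _ G00).
have -> : G 0 0 * (G 0 0 * v 0 0 ^+ 2 + (G 0 1 + G 0 1) * (v 0 0 * v 1 0)
    + G 1 1 * v 1 0 ^+ 2) = (G 0 0 * v 0 0 + G 0 1 * v 1 0) ^+ 2
    + (G 0 0 * G 1 1 - G 0 1 ^+ 2) * v 1 0 ^+ 2 by ring.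
rewrite dG mul1r lt_def addr_ge0 ?sqr_ge0// andbT.
apply: contra v0; rewrite paddr_eq0 ?sqr_ge0// !sqrf_eq0 => /andP[+ /eqP v1].
rewrite v1 mulr0 addr0 mulf_eq0 gt_eqF//= => /eqP v0.
apply/eqP/matrixP => i j; rewrite (ord1 j) mxE.
case: i => [[|[|//]] li]; [rewrite -[RHS]v0|rewrite -[RHS]v1];
  by congr (v _ _); apply: val_inj.
Qed.

(** Since [invmx G] is the adjugate of [G], the trace condition is the linearized determinant
    equation at [G]. *)
Lemma tangent_unit_flatP (R : realType) (G H : 'M[R]_2) : unit_flat G ->
  tangent_unit_flat G H <-> [/\ H 1 0 = H 0 1 &
    G 1 1 * H 0 0 - 2 * G 0 1 * H 0 1 + G 0 0 * H 1 1 = 0].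
Proof.
move=> UG; have [G10 _ _] := (unit_flatP _).1 UG.
have trE : H 1 0 = H 0 1 -> \tr (invmx G *m H) =
    G 1 1 * H 0 0 - 2 * G 0 1 * H 0 1 + G 0 0 * H 1 1.
  move=> H10; have [i00 i01 i10 i11] := invmx2E UG.2.
  rewrite /mxtrace !big_ord_recl !big_ord0 !mxE !big_ord_recl !big_ord0.
  have -> : lift ord0 ord0 = 1 :> 'I_2 by apply: val_inj.
  have -> : ord0 = 0 :> 'I_2 by apply: val_inj.
  rewrite i00 i01 i10 i11 H10 G10; ring.
split=> [[symH trH]|[H10 eH]].
  have H10 : H 1 0 = H 0 1 by rewrite -[in LHS]symH mxE.
  by split=> //; rewrite -trE.
split; last by rewrite trE.
by apply: mx2P; rewrite !mxE.
Qed.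

(** * Energies of the torus maps *)

Fact torus_map_is_linear (R : realType) (m : int * int) :
  linear (@torus_map R m).
Proof. by move=> a x y; rewrite /torus_map /= /GRing.scale /=; ring. Qed.

HB.instance Definition _ (R : realType) (m : int * int) :=
  GRing.isLinear.Build R (R * R)%type R _ (@torus_map R m)
    (@torus_map_is_linear R m).

Lemma continuous_torus_map (R : realType) (m : int * int) :
  continuous (@torus_map R m).
Proof.
move=> x; apply: cvgD; apply: cvgMl_tmp; [exact: cvg_fst|exact: cvg_snd].
Qed.

Lemma derive_torus_map (R : realType) (m : int * int) (x v : R * R) :
  'D_v (torus_map m) x = torus_map m v.
Proof.
have mc := @continuous_torus_map R m.
by rewrite deriveE ?diff_lin//; exact: linear_differentiable.
Qed.

(** The differential of [torus_map m] is the constant covector [m] and the volume factor is 1; what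
    remains is half the quadratic form of the adjugate at [m]. *)
Lemma energyE (R : realType) (m : int * int) (G : 'M[R]_2) : \det G = 1 ->
  energy m G = 2^-1 * (m.1%:~R ^+ 2 * G 1 1
     - m.1%:~R * m.2%:~R * (G 0 1 + G 1 0) + m.2%:~R ^+ 2 * G 0 0).
Proof.
move=> dG; have [i00 i01 i10 i11] := invmx2E dG.
have dliftE (x : R * R) :
    dlift (torus_map m) x = \row_i (if i == 0 then m.1 else m.2)%:~R.
  apply/rowP => i; rewrite !mxE.
  by case: ifP => _;
    rewrite derive_torus_map /torus_map/= !(mulr0, mulr1, addr0, add0r).
rewrite /energy /dirichlet_energy dG sqrtr1; congr (_ * _).
under eq_Rintegral do rewrite /sqnorm_d dliftE mulr1.
(* The integrand is constant, so only the measure of the unit square, which is 1, is needed. *)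
rewrite Rintegral_cst; last exact: measurableX.
rewrite [X in fine X](_ : _ = 1%E) ?mulr1; last first.
  apply: etrans; first exact: product_measure1E.
  have l1 := lebesgue_measure_itv (R := R) `[0, 1].
  rewrite /= lte_fin ltr01 sube0 in l1.
  by rewrite -[RHS]mule1; congr (_ * _)%E; exact: l1.
(* The row is written as a double transpose to match [qform2E], which is stated for columns. *)
set r := \row_i _; rewrite -{1}(trmxK r) qform2E !mxE/=.
rewrite i00 i01 i10 i11; ring.
Qed.

(** * The linear map extending [Theta] *)

(** Being defined on all matrices, it is the ambient extension that [smooth_on] asks for; keeping
    [G 0 1] and [G 1 0] apart mirrors [energyE]. *)
Definition energy_form (R : realType) (G : 'M[R]_2) : 'rV[R]_3 :=
  \row_(i < 3) tnth [tuple G 1 1 / 2; G 0 0 / 2;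
                     (G 0 0 + G 1 1 - G 0 1 - G 1 0) / 2] i.

Lemma ord3P (P : 'I_3 -> Prop) : P 0 -> P 1 -> P 2 -> forall i, P i.
Proof.
move=> P0 P1 P2 [[|[|[|//]]] li].
- by rewrite (_ : Ordinal li = 0)//; apply: val_inj.
- by rewrite (_ : Ordinal li = 1)//; apply: val_inj.
- by rewrite (_ : Ordinal li = 2)//; apply: val_inj.
Qed.

Lemma ThetaE (R : realType) (G : 'M[R]_2) :
  unit_flat G -> Theta G = energy_form G.
Proof.
by move=> UG; apply/rowP; apply: ord3P; rewrite !mxE energyE ?UG.2//=
  !(tnth_nth 0)/=; field.
Qed.

Fact energy_form_is_linear (R : realType) : linear (@energy_form R).
Proof.
by move=> a x y; apply/rowP; apply: ord3P; rewrite !mxE !(tnth_nth 0)/=; field.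
Qed.

HB.instance Definition _ (R : realType) :=
  GRing.isLinear.Build R 'M[R]_2 'rV[R]_3 _ (@energy_form R)
    (@energy_form_is_linear R).

Lemma continuous_energy_form (R : realType) : continuous (@energy_form R).
Proof.
(* Expansion in the standard basis of rows reduces continuity to the three scalar coordinates. *)
have cE : @energy_form R =
    (fun G => \sum_(i < 3) energy_form G 0 i *: delta_mx 0 i).
  by apply/funext => G; rewrite [LHS]row_sum_delta.
rewrite cE => G; apply: cvg_big => [||i _];
  [exact: add_continuous|exact: nbhs_filter|].
apply: (@cvgZr_tmp R 'rV[R]_3 _ (nbhs G) _ (fun G => energy_form G 0 i)).
have cc j k : {for G, continuous (fun M : 'M[R]_2 => M j k : R)}.
  exact: coord_continuous.
have c2 (f : 'M[R]_2 -> R) : {for G, continuous f} ->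
    {for G, continuous (fun M => f M / 2)}.
  by move=> cf; apply: continuousM => //; exact: cst_continuous.
move: i; apply: ord3P; under eq_fun do rewrite /energy_form mxE (tnth_nth 0)/=;
  rewrite /energy_form mxE (tnth_nth 0)/=; apply: c2 => //.
by apply: continuousB => //; apply: continuousB => //; exact: continuousD.
Qed.

(** The first two coordinates recover the diagonal; the third then gives the sum of the off-diagonal
    entries, which symmetry splits equally. *)
Lemma energy_form_inj (R : realType) (G H : 'M[R]_2) :
  G 1 0 = G 0 1 -> H 1 0 = H 0 1 -> energy_form G = energy_form H -> G = H.
Proof.
move=> G10 H10 /rowP GH.
have := GH 2; have := GH 1; have := GH 0; rewrite !mxE !(tnth_nth 0)/=.
by rewrite G10 H10 => h1 h0 h2; apply: mx2P; rewrite G10 H10; split; lra.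
Qed.

(** * Curves in [unit_flat] and the differential of [Theta] *)

(* The entries [G 0 0] and [G 0 1] are global coordinates of [unit_flat];
   moving them linearly gives a curve, whose last entry is determined by
   the determinant. *)
Definition unit_flat_curve (R : realType) (p v : 'M[R]_2) (t : R) : 'M[R]_2 :=
  let a := p 0 0 + t * v 0 0 in
  let b := p 0 1 + t * v 0 1 in
  \matrix_(i, j) (if i == 0 then (if j == 0 then a else b)
                  else (if j == 0 then b else (1 + b ^+ 2) / a)).

Lemma unit_flat_curveP (R : realType) (p v : 'M[R]_2) :
  unit_flat p -> tangent_unit_flat p v ->
  curve_at unit_flat p v (unit_flat_curve p v).
Proof.
move=> Up Tv; have [p10 p00 dp] := (unit_flatP _).1 Up.
have [v10 ev] := (tangent_unit_flatP _ Up).1 Tv.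
have p00N0 : p 0 0 != 0 by rewrite gt_eqF.
have p11 : p 1 1 = (1 + p 0 1 ^+ 2) / p 0 0.
  by apply: (mulfI p00N0); rewrite mulrCA divff// mulr1 -dp; ring.
have dlin (x y : R) : is_derive (0 : R) 1 (fun t => x + t * y) y.
  have -> : (fun t => x + t * y) = cst x + y \*: id.
    by apply/funext => t; rewrite !fctE /GRing.scale/= mulrC.
  by apply: is_derive_eq; rewrite add0r /GRing.scale/= mulr1.
split.
- by apply: mx2P; rewrite !mxE/= !mul0r !addr0 p10 p11.
(* The determinant is 1 wherever the entry [(0, 0)] is nonzero, so staying in [unit_flat] only
   requires that entry to stay positive, which continuity gives near 0. *)
- have : (p 0 0 + t * v 0 0) @[t --> (0 : R)] --> p 0 0.
    rewrite -[X in _ --> X]addr0 -[X in _ + X](mul0r (v 0 0)).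
    by apply: cvgD; [exact: cvg_cst|apply: cvgMr_tmp; exact: cvg_id].
  move=> /(cvgr_gt (p 0 0)) - /(_ 0 p00); apply: filterS => t at0.
  apply/unit_flatP; rewrite !mxE/=; split=> //.
  by rewrite mulrC divfK ?gt_eqF//; ring.
- have dj i j : is_derive (0 : R) 1 (fun t => unit_flat_curve p v t i j) (v i j).
    have da := dlin (p 0 0) (v 0 0); have db := dlin (p 0 1) (v 0 1).
    set a := fun t => _ in da; set b := fun t => _ in db.
    have a0 : a 0 != 0 by rewrite /a mul0r addr0.
    have entryE f i' j' d : (forall t, unit_flat_curve p v t i' j' = f t) ->
        is_derive (0 : R) 1 f d ->
        is_derive (0 : R) 1 (fun t => unit_flat_curve p v t i' j') d.
      by move=> fE; rewrite (_ : (fun t => _) = f)//; apply/funext.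
    move: i j; apply: ord2P; apply: ord2P.
    + by apply: entryE da => t; rewrite mxE.
    + by apply: entryE db => t; rewrite mxE.
    + by rewrite v10; apply: entryE db => t; rewrite mxE.
    apply: (entryE ((cst 1 + b * b) * (fun t => (a t)^-1))).
      by move=> t; rewrite mxE.
    have dV := is_deriveV a0 da.
    apply: is_derive_eq; rewrite !fctE /GRing.scale/= /a /b !mul0r !addr0 add0r.
    (* Subtracting the left side of the tangency equation [ev], which is zero, eliminates
       [v 1 1]. *)
    apply: (mulfI p00N0); rewrite -[RHS]addr0 -[X in _ = _ + X](oppr0) -ev p11.
    by field.
  have dc : derivable (unit_flat_curve p v) 0 1.
    by apply/derivable_mxP => i j; have [] := dj i j.
  split=> //; rewrite derive_mx//; apply/matrixP => i j; rewrite mxE.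
  by have [] := dj i j.
Qed.

Lemma mdiff_Theta (R : realType) (p v : 'M[R]_2) :
  unit_flat p -> tangent_unit_flat p v ->
  mdiff unit_flat Theta p v = energy_form v.
Proof.
(* The default value of [xget] is excluded by [unit_flat_curveP]; the computation below works for
   whichever curve was chosen. *)
move=> Up Tv; rewrite /mdiff; case: xgetP => [c _ [c0 Uc cv]|]; last first.
  by move=> /(_ _ (unit_flat_curveP Up Tv)).
have dE x : differentiable (@energy_form R) x.
  by apply: linear_differentiable; exact: continuous_energy_form.
have dc : differentiable c 0 by apply/derivable1_diffP.
rewrite derive1E; transitivity ('D_1 (@energy_form R \o c) 0).
  (* The curve lies in [unit_flat] only near 0, and [Theta] is known to be linear only there, so the
     two composites are compared locally. *)
  by apply: near_eq_derive; apply: filterS Uc => t Ut /=; rewrite ThetaE.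
rewrite deriveE; last exact: differentiable_comp.
rewrite diff_comp//= diff_lin; last exact: continuous_energy_form.
by rewrite -deriveE// derive_val.
Qed.

(** * The pulled back metric *)

Lemma tangent_unit_flat_linear (R : realType) (p u v : 'M[R]_2) (a : R) :
  tangent_unit_flat p u -> tangent_unit_flat p v ->
  tangent_unit_flat p (a *: u + v).
Proof.
move=> [su tu] [sv tv]; split; first by rewrite linearP/= su sv.
by rewrite mulmxDr -scalemxAr linearP/= tu tv mulr0 addr0.
Qed.

(** A named coordinate map can carry the linear structure that [Ck_linear_comp] expects. *)
Definition mx_entry (R : realType) m n (i : 'I_m) (j : 'I_n)
  (A : 'M[R]_(m, n)) : R := A i j.

Fact mx_entry_is_linear (R : realType) m n (i : 'I_m) (j : 'I_n) :
  linear (@mx_entry R m n i j).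
Proof. by move=> a A B; rewrite /mx_entry !mxE. Qed.

HB.instance Definition _ (R : realType) m n (i : 'I_m) (j : 'I_n) :=
  GRing.isLinear.Build R 'M[R]_(m, n) R _ (@mx_entry R m n i j)
    (@mx_entry_is_linear R m n i j).

Lemma continuous_mx_entry (R : realType) m n (i : 'I_m) (j : 'I_n) :
  continuous (@mx_entry R m n i j).
Proof. exact: coord_continuous. Qed.

Theorem theorem9p1 (R : realType) :
  [/\ {in @unit_flat R &, injective (@Theta R)},
      smooth_on (@unit_flat R) (@Theta R),
      forall G : 'M[R]_2, unit_flat G ->
        {in tangent_unit_flat G &, injective (mdiff unit_flat Theta G)}
    & riemannian_metric (@unit_flat R) tangent_unit_flat
        (pullback unit_flat Theta euclidean_metric)].
Proof.
have Tsym (G H : 'M[R]_2) : tangent_unit_flat G H -> H 1 0 = H 0 1.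
  by move=> [symH _]; rewrite -[in LHS]symH mxE.
split.
- move=> G H; rewrite !inE => UG UH; rewrite !ThetaE//.
  by apply: energy_form_inj; [case/unit_flatP: UG|case/unit_flatP: UH].
- move=> p Up; exists setT, (@energy_form R); split=> //.
  + exact: openT.
  + by move=> k; apply: Ck_linear; exact: continuous_energy_form.
  + by move=> q _ Uq; rewrite ThetaE.
- move=> G UG v w; rewrite !inE => Tv Tw; rewrite !mdiff_Theta//.
  by apply: energy_form_inj; [exact: Tsym Tv|exact: Tsym Tw].
split.
- move=> p Up a u v w Tu Tv Tw; have Tuv := tangent_unit_flat_linear a Tu Tv.
  rewrite /pullback /euclidean_metric !mdiff_Theta// mulr_sumr -big_split/=.
  by apply: eq_bigr => i _; rewrite linearP !mxE; ring.
- move=> p Up v w Tv Tw; rewrite /pullback /euclidean_metric !mdiff_Theta//.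
  by apply: eq_bigr => i _; rewrite mulrC.
- move=> p Up v Tv v0; rewrite /pullback /euclidean_metric !mdiff_Theta//.
  rewrite lt_def sumr_ge0 ?andbT; last by move=> i _; rewrite -expr2 sqr_ge0.
  (* A vanishing sum of squares forces [energy_form v = 0 = energy_form 0], so [v = 0] by
     injectivity on symmetric matrices. *)
  apply: contra v0; rewrite psumr_eq0; last first.
    by move=> i _; rewrite -expr2 sqr_ge0.
  move=> /allP v0; apply/eqP; apply: energy_form_inj; first exact: Tsym Tv.
    by rewrite !mxE.
  rewrite linear0; apply/rowP => i; rewrite [RHS]mxE.
  have := v0 i; rewrite mem_index_enum => /(_ isT).
  by rewrite mulf_eq0 orbb => /eqP.
- move=> X Y sX TX sY TY p Up.
  have [U [F [oU Up1 sF FX]]] := sX p Up.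
  have [U' [F' [oU' Up2 sF' FY]]] := sY p Up.
  (* The local extension pairs the ambient extensions [F], [F'] of the two fields through
     [energy_form]; on [unit_flat] they are tangent, so [mdiff_Theta] identifies it with the
     metric. *)
  exists (U `&` U'), (fun q => \sum_(i < 3)
    energy_form (F q) 0 i * energy_form (F' q) 0 i).
  have oUU' : open (U `&` U') by exact: openI.
  split=> //; last first.
    move=> q [Uq U'q] Mq; rewrite /pullback /euclidean_metric.
    rewrite !mdiff_Theta//; [|exact: TY|exact: TX].
    by rewrite FX// FY.
  move=> k; apply: Ck_sum => // i.
  have Ccoord (H : 'M[R]_2 -> 'M[R]_2) : Ck k (U `&` U') H ->
      Ck k (U `&` U') (fun q => energy_form (H q) 0 i).
    move=> /(Ck_linear_comp oUU' (@continuous_energy_form R)) CH.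
    exact: (Ck_linear_comp oUU' (@continuous_mx_entry R 1 3 0 i) CH).
  apply: CkM => //; apply: Ccoord; [apply: Ck_subset (sF k)|
    apply: Ck_subset (sF' k)]; by move=> x [].
Qed.
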